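(* Let $1\le l\le m\le n$ be integers and let $v=(v_1,\dots,v_l)\in[n]^l$ be strictly increasing. The number of parking functions $\pi\in \mathrm{PF}(m,n)$ with $\pi_1=v_1,\dots,\pi_l=v_l$ is $$(n-m+1)\sum_{s\in S_l(v)}\binom{m-l}{s}(s_1+1+n-m)^{s_1-1}\prod_{i=2}^{l+1}(s_i+1)^{s_i-1},$$ where $$S_l(v)=\Big\{s=(s_1,\dots,s_{l+1})\in\mathbb N^{l+1}:\ s_1+\cdots+s_i\ge m-n+v_i-i\ \ \forall i\in[l],\ \ s_1+\cdots+s_{l+1}=m-l\Big\}.$$ Moreover, this quantity takes the same value for all $v$ with $v_i\le n-m+i$ for all $i\in[l]$, and it decreases as any $v_i$ increases past $n-m+i$: if $v,v'\in[n]^l$ are strictly increasing, differ only in the $i$th coordinate, and $n-m+i\le v_i<v_i'$, then the number for $v'$ is smaller than the number for $v$.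
   Context: Write $[n]=\{1,\dots,n\}$ and $\mathbb N=\{0,1,2,\dots\}$. For integers $0\le m\le n$, $\mathrm{PF}(m,n)$ denotes the set of parking functions with $m$ cars and $n$ spots: sequences $(\pi_1,\dots,\pi_m)\in[n]^m$ such that, when cars $1,\dots,m$ enter in order a one-way street with spots $1,\dots,n$ and car $i$ parks in spot $\pi_i$ if it is free and otherwise in the first free spot after $\pi_i$, all cars park. Equivalently, the non-decreasing rearrangement $(\lambda_1,\dots,\lambda_m)$ satisfies $\lambda_i\le n-m+i$ for all $i$. For $s=(s_1,\dots,s_{l+1})$ with sum $m-l$, $\binom{m-l}{s}=\frac{(m-l)!}{s_1!\cdots s_{l+1}!}$. Powers with exponent $-1$ are taken in $\mathbb Q$. *)

(* Defs.v *)
From mathcomp Require Import all_boot all_order all_algebra.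
Set Implicit Arguments.
Unset Strict Implicit.
Unset Printing Implicit Defensive.
Import GRing.Theory Num.Theory.

Local Open Scope nat_scope.

(* The spots 1, ..., n are the elements of 'I_n, x : 'I_n standing for spot
   x.+1; a sequence in [n]^l is an l.-tuple 'I_n. Indices are shifted in the
   same way: i : 'I_l stands for the index i.+1 in [l]. *)
Definition spot (n l : nat) (v : l.-tuple 'I_n) (i : 'I_l) : nat :=
  (tnth v i).+1.

Definition strictly_increasing (n l : nat) (v : l.-tuple 'I_n) : Prop :=
  forall i j : 'I_l, i < j -> spot v i < spot v j.

(* First free spot at or after p; enum 'I_n is in increasing order. *)
Definition park_spot (n : nat) (occ : {set 'I_n}) (p : 'I_n) : option 'I_n :=
  ohead [seq q : 'I_n <- enum 'I_n | (p <= q) && (q \notin occ)].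

Fixpoint all_park (n : nat) (occ : {set 'I_n}) (prefs : seq 'I_n) : bool :=
  if prefs is p :: prefs' then
    if park_spot occ p is Some q then all_park (q |: occ) prefs' else false
  else true.

Definition PF (m n : nat) : {set m.-tuple 'I_n} :=
  [set pi : m.-tuple 'I_n | all_park set0 pi].

Definition num_PF (m n l : nat) (v : l.-tuple 'I_n) : nat :=
  #|[set pi in PF m n | take l pi == v :> seq 'I_n]|.

(* The lower bound m - n + v_i - i may be negative, so it is taken in int. *)
Definition in_S (m n l : nat) (v : l.-tuple 'I_n) (s : 'I_l.+1 -> nat) : bool :=
  [forall i : 'I_l,
     (m%:Z - n%:Z + (spot v i)%:Z - (i.+1)%:Z
        <= (\sum_(j < l.+1 | j <= i) s j)%N%:Z)%R]
  && (\sum_(j < l.+1) s j == m - l).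

(* Hence S_l(v) can be enumerated through functions 'I_l.+1 -> 'I_(m - l).+1. *)
Lemma in_S_bound (m n l : nat) (v : l.-tuple 'I_n) (s : 'I_l.+1 -> nat) :
  in_S m v s -> forall j, s j < (m - l).+1.
Proof.
by case/andP=> _ /eqP <- j; rewrite ltnS (bigD1 j) //= leq_addr.
Qed.

Local Open Scope ring_scope.

Definition multinomial (k l : nat) (s : 'I_l -> nat) : rat :=
  (k`!)%:R / \prod_(j < l) ((s j)`!)%:R.

Definition PF_summand (m n l : nat) (s : 'I_l.+1 -> nat) : rat :=
  multinomial (m - l) s
  * ((s ord0)%:R + 1 + n%:R - m%:R) ^ ((s ord0)%:Z - 1)
  * \prod_(j < l.+1 | j != ord0) ((s j)%:R + 1) ^ ((s j)%:Z - 1).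

Definition PF_formula (m n l : nat) (v : l.-tuple 'I_n) : rat :=
  (n%:R - m%:R + 1)
  * \sum_(s : {ffun 'I_l.+1 -> 'I_(m - l).+1} | in_S m v (fun j => s j))
      PF_summand m n (fun j => s j).

(* Main.v *)
(* Park the last m - l cars first. They leave n - m + l spots empty; let
   e_1 < ... < e_l be the last l of these. As the outcome does not depend on the
   order of the cars, all cars park iff v_i <= e_i for all i. If s_1, ..., s_{l+1}
   count the cars parked before e_1, between e_1 and e_2, ..., after e_l, then
   e_i = n - m + s_1 + ... + s_i + i, so that v_i <= e_i is the inequality
   defining S_l(v), and the cars of each block form a parking function.

   To count, let the walk u have u(j) = j - #{cars preferring a spot <= j}. It
   goes up by at most 1 per step, and e_i is the first time it reaches level
   n - m + i. Splitting at first passages turns the count, divided by (m - l)!,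
   into a convolution, whose factors are given by the ballot theorem.

   The last two claims compare the index sets S_l(v) in the formula. *)
Require Import Defs.
From mathcomp Require Import all_boot all_order all_algebra.
From mathcomp Require Import zify ring lra.
Set Implicit Arguments.
Unset Strict Implicit.
Unset Printing Implicit Defensive.
Import Order.TTheory GRing.Theory Num.Theory.

Local Open Scope nat_scope.

(** * Sums over words *)

(** Words are lists of numbers rather than tuples over ['I_n], so that letters can be deleted and
    the alphabet changed without casts. *)
Fixpoint word_sum (V : nmodType) (n k : nat) (F : seq nat -> V) : V :=
  if k is k'.+1 then (\sum_(x < n) word_sum n k' (fun w => F (val x :: w)))%R
  else F [::].

Section WordSum.
Variable V : nmodType.
Implicit Types F : seq nat -> V.
Local Open Scope ring_scope.

Lemma eq_word_sum n k F F' :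
    (forall w, size w = k -> all (gtn n) w -> F w = F' w) ->
  word_sum n k F = word_sum n k F'.
Proof.
elim: k F F' => [|k IH] F F' eqF /=; first exact: eqF.
apply: eq_bigr => x _; apply: IH => w sw nw; apply: eqF => /=.
  by rewrite sw.
by rewrite nw andbT; apply: ltn_ord.
Qed.

Lemma word_sum0 n k : word_sum n k (fun=> 0 : V) = 0.
Proof. by elim: k => //= k IH; rewrite big1. Qed.

Lemma exchange_word_sum n k (I : finType) (P : pred I) (F : I -> seq nat -> V) :
  word_sum n k (fun w => \sum_(i | P i) F i w) =
  \sum_(i | P i) word_sum n k (F i).
Proof.
elim: k F => //= k IH F.
rewrite [RHS]exchange_big; apply: eq_bigr => x _ /=.
exact: (IH (fun i w => F i (val x :: w))).
Qed.

Lemma word_sum_rcons n k F :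
  word_sum n k.+1 F = word_sum n k (fun w => \sum_(x < n) F (rcons w (val x))).
Proof.
elim: k F => // k IH F; apply: eq_bigr => x _.
exact: (IH (fun w => F (val x :: w))).
Qed.

Lemma sum_tuple_word n k F :
  \sum_(t : k.-tuple 'I_n) F (map val t) = word_sum n k F.
Proof.
elim: k F => [|k IH] F /=.
  rewrite (big_pred1 [tuple]) // => t; rewrite [t]tuple0; exact/esym/eqP.
rewrite (reindex (fun p : 'I_n * k.-tuple 'I_n => [tuple of p.1 :: p.2])) /=.
  rewrite -(pair_bigA _ (fun (x : 'I_n) (t : k.-tuple 'I_n) =>
    F (val x :: map val t))) /=.
  by apply: eq_bigr => x _; apply: (IH (fun w => F (val x :: w))).
exists (fun t => (thead t, behead_tuple t)) => [[x t] _|t _] /=.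
  by rewrite theadE; congr pair; apply: val_inj.
by rewrite -tuple_eta.
Qed.

Lemma sum_ffun_word n k F :
  \sum_(s : {ffun 'I_k -> 'I_n}) F [seq val (s i) | i <- enum 'I_k] =
  word_sum n k F.
Proof.
rewrite -sum_tuple_word (reindex (fun t : k.-tuple 'I_n => [ffun i => tnth t i])).
  apply: eq_bigr => t _; congr F.
  rewrite -[in RHS](map_tnth_enum t) -[RHS]map_comp.
  by apply: eq_map => i /=; rewrite ffunE.
exists (fun s : {ffun 'I_k -> 'I_n} => [tuple s i | i < k]) => [t _|s _].
  by apply: eq_from_tnth => i; rewrite tnth_mktuple ffunE.
by apply/ffunP => i; rewrite ffunE tnth_mktuple.
Qed.

(** Deleting the largest letter: each word of length [i] over the smaller alphabet arises once for
    every choice of the [i] positions kept. The induction step is Pascal's rule. *)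
Lemma word_sum_filter n k F :
  word_sum n.+1 k (fun w => F (filter (gtn n) w)) =
  \sum_(i < k.+1) word_sum n i F *+ 'C(k, i).
Proof.
elim: k F => [|k IH] F /=; first by rewrite big_ord1.
rewrite big_ord_recr /= ltnn IH.
under eq_bigr => x _ do rewrite ltn_ord (IH (fun w => F (val x :: w))).
rewrite exchange_big /=.
under eq_bigr => i _ do rewrite sumrMnl -/(word_sum n i.+1 F).
rewrite [RHS]big_ord_recl /= bin0.
under [in RHS]eq_bigr => i _ do
  rewrite /bump leq0n add1n binS mulrnDr.
rewrite big_split /= [RHS]addrA [RHS]addrC; congr (_ + _).
rewrite big_ord_recl bin0 [X in _ = _ + X]big_ord_recr /= bin_small //.
by rewrite mulr0n addr0.
Qed.

Lemma word_sum_cat (n k : nat) (v : seq nat) F : all (gtn n) v ->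
  word_sum n (size v + k) (fun w => if take (size v) w == v then F w else 0)
  = word_sum n k (fun w => F (v ++ w)).
Proof.
elim: v F => [|x v IH] F /=.
  by move=> _; apply: eq_word_sum => w _ _; rewrite take0.
case/andP=> xn vn; rewrite (bigD1 (Ordinal xn)) //= [X in _ + X]big1 ?addr0.
  rewrite -(IH (fun w => F (x :: w))) //; apply: eq_word_sum => w _ _.
  by rewrite eqseq_cons eqxx.
move=> y /negPf yx; rewrite -[RHS](word_sum0 n (size v + k)).
apply: eq_word_sum => w _ _; rewrite eqseq_cons.
by move: yx; rewrite -val_eqE /= => ->.
Qed.

End WordSum.

Lemma word_sum_mulr (R : pzSemiRingType) n k (F : seq nat -> R) c :
  word_sum n k (fun w => F w * c)%R = (word_sum n k F * c)%R.
Proof.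
elim: k F => //= k IH F; rewrite mulr_suml; apply: eq_bigr => x _.
exact: (IH (fun w => F (val x :: w))).
Qed.

(** * The outcome of parking *)

(* The letters of a word are spots counted from 0, as in 'I_n. *)
Definition parks (n : nat) (s : seq nat) : bool :=
  all (fun j => count (leq j) s <= n - j) (iota 0 n.+1).

Section Park.
Variable n : nat.
Implicit Types (occ : {set 'I_n}) (p q : 'I_n).

Definition occ_ge occ j := #|[set q in occ | j <= q]|.

Lemma occ_ge_le occ j : occ_ge occ j <= n - j.
Proof.
rewrite -(card_ord n) /occ_ge.
have [jn|nj] := leqP j n; last first.
  rewrite (_ : [set q in occ | j <= q] = set0) ?cards0 //.
  by apply/setP => q; rewrite !inE; have := ltn_ord q; lia.
have e : #|[set q : 'I_n | j <= q]| = n - j.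
  rewrite -sum1dep_card -(big_mkord (leq j) (fun=> 1)) big_mkcond /=.
  rewrite (big_cat_nat (n := j)) //= big_nat big1 ?add0n; last first.
    by move=> i; case: leqP.
  rewrite big_nat (eq_bigr (fun=> 1)) -?big_nat ?sum_nat_const_nat ?muln1 //.
  by move=> i /andP[-> _].
rewrite card_ord -e; apply: subset_leq_card.
by apply/subsetP => q; rewrite !inE => /andP[].
Qed.

Lemma occ_geS occ (j : 'I_n) :
  occ_ge occ j = (j \in occ) + occ_ge occ j.+1.
Proof.
rewrite /occ_ge (cardsD1 j) !inE leqnn andbT; congr (_ + _).
apply: eq_card => q; rewrite !inE -val_eqE /=; case: (q \in occ) => //=; lia.
Qed.

Lemma occ_geU occ q j : q \notin occ ->
  occ_ge (q |: occ) j = (j <= q) + occ_ge occ j.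
Proof.
move=> qocc; rewrite /occ_ge (cardsD1 q) !inE eqxx /=; congr (_ + _).
apply: eq_card => r; rewrite !inE; case: eqVneq => [->|] //=.
by rewrite (negPf qocc).
Qed.

Lemma park_spotP occ p :
  match park_spot occ p with
  | Some q => [/\ p <= q, q \notin occ
                & forall r : 'I_n, p <= r -> r < q -> r \in occ]
  | None => forall r : 'I_n, p <= r -> r \in occ
  end.
Proof.
rewrite /park_spot.
have mem : [seq q : 'I_n <- enum 'I_n | (p <= q) && (q \notin occ)] =i
   [pred q : 'I_n | (p <= q) && (q \notin occ)].
  by move=> q; rewrite mem_filter mem_enum andbT.
have srt : sorted (fun x y : 'I_n => x < y)
    [seq q : 'I_n <- enum 'I_n | (p <= q) && (q \notin occ)].
  apply: sorted_filter; first by move=> a b c; apply: ltn_trans.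
  have := iota_ltn_sorted 0 n; rewrite -val_enum_ord sorted_map.
  exact.
move: mem srt; case: filter => [|q s] mem srt /=.
  by move=> r pr; have := mem r; rewrite !inE pr /= => /esym/negbFE.
have : q \in q :: s by rewrite inE eqxx.
rewrite mem => /andP[pq qo]; split => // r pr rq.
apply/negPn/negP => ro; have : r \in q :: s by rewrite mem inE pr.
rewrite inE => /orP[/eqP e|rs]; first by rewrite e ltnn in rq.
have /allP /(_ r rs) : all (fun y : 'I_n => q < y) s.
  by apply: order_path_min srt => a b c; apply: ltn_trans.
by rewrite /=; lia.
Qed.

(** Stated for a partly occupied street so that induction over the cars applies: occupied spots and
    pending preferences from [j] on must together fit into [n - j] spots. *)
Lemma all_parkE occ (s : seq 'I_n) :
  all_park occ s =
  all (fun j => count (leq j) (map (@nat_of_ord n) s) + occ_ge occ j <= n - j)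
    (iota 0 n.+1).
Proof.
have rE j : (j \in iota 0 n.+1) = (j <= n) by rewrite mem_iota.
move: (iota _ _) rE => r rE.
elim: s occ => [|p s IH] occ /=.
  by apply/esym/allP => j _; apply: occ_ge_le.
case: park_spot (park_spotP occ p) => [q [pq qo pqo]|full].
- have run (j : nat) : p <= j -> j <= q -> occ_ge occ p = (j - p) + occ_ge occ j.
    elim: j => [|j IHj] pj jq; first by have -> : p = 0 :> nat by lia.
    have [->|pj'] := eqVneq (p : nat) j.+1; first by rewrite subnn.
    have jn : j < n by have := ltn_ord q; lia.
    rewrite IHj; [|lia|lia].
    rewrite (occ_geS occ (Ordinal jn)) pqo //=; lia.
  rewrite IH; apply/idP/idP => /allP H; apply/allP => j jn.
    move: (H j jn); rewrite occ_geU //=; lia.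
  rewrite occ_geU //; have := H j jn.
  have [jp|pj] := leqP j p; first rewrite (leq_trans jp pq).
    lia.
  have [jq|] := leqP j q; last by lia.
  (* For [p < j <= q] the newly taken spot [q] counts at [j] but the preference [p] does not. The
     inequality at [p] still suffices, because the spots from [p] to [j - 1] are all occupied. *)
  have pn : (p : nat) \in r by rewrite rE; have := ltn_ord p; lia.
  move: (H (p : nat) pn); rewrite leqnn (run j (ltnW pj) jq).
  have : count (leq j) (map (@nat_of_ord n) s) <= count (leq p) (map (@nat_of_ord n) s).
    by apply: sub_count => x /=; lia.
  have := ltn_ord q; lia.
- apply/esym/negbTE/allPn; exists (p : nat).
    by rewrite rE; have := ltn_ord p; lia.
  (* The street is full from [p] on, so one more car preferring [p] violates the inequality at
     [p]. *)
  have run k : p + k <= n -> occ_ge occ p = k + occ_ge occ (p + k).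
    elim: k => [|k IHk] pk; first by rewrite addn0.
    have kn : p + k < n by lia.
    rewrite IHk; last lia.
    rewrite (occ_geS occ (Ordinal kn)) full /=; last by lia.
    by rewrite addnS; lia.
  have := run (n - p); have := ltn_ord p.
  rewrite leqnn; lia.
Qed.

Lemma all_park0E (s : seq 'I_n) : all_park set0 s = parks n (map (@nat_of_ord n) s).
Proof.
rewrite all_parkE; apply: eq_all => j.
rewrite (_ : occ_ge set0 j = 0) ?addn0 //.
by apply/eqP; rewrite cards_eq0; apply/eqP/setP => q; rewrite !inE.
Qed.
End Park.

(** * Weighted lattice paths *)

Section PathWeight.
Implicit Types b : nat -> nat.
Local Open Scope ring_scope.

(* Sum of the products of 1 / c_j! over all c_1 + ... + c_n = k whose partial sums
   satisfy c_1 + ... + c_j >= b j. Here c_j is the number of letters j - 1 of a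
   word, so k! times this sum counts words (word_sum_bounded). *)
Fixpoint path_weight b (n k : nat) : rat :=
  if n is n'.+1 then
    if (b n <= k)%N then \sum_(i < k.+1) path_weight b n' i / (k - i)`!%:R else 0
  else (k == 0%N)%:R.

Lemma path_weightS b n k :
  path_weight b n.+1 k =
  if (b n.+1 <= k)%N then \sum_(i < k.+1) path_weight b n i / (k - i)`!%:R else 0.
Proof. by []. Qed.

Lemma eq_path_weight b b' n k : (forall j, (0 < j <= n)%N -> b j = b' j) ->
  path_weight b n k = path_weight b' n k.
Proof.
elim: n k => // n IH k eqb; rewrite !path_weightS eqb ?leqnn //.
case: ifP => // _; apply: eq_bigr => i _; rewrite IH // => j /andP[j0 jn].
by apply: eqb; rewrite j0 leqW.
Qed.

Lemma path_weight_small b n k : b 0%N = 0%N -> (k < b n)%N ->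
  path_weight b n k = 0.
Proof.
move=> b0; case: n => [|n] kb; first by move: kb; rewrite b0.
by rewrite path_weightS leqNgt kb.
Qed.

Definition bounded b n (w : seq nat) : bool :=
  all (fun j => b j <= count (gtn j) w)%N (iota 1 n).

(** Induction on the alphabet: the last bound concerns only the length, the others only the word
    without its largest letter. Then ['C(k, i) * i! = k! / (k - i)!] yields the factor
    [1 / (k - i)!] of the weight. *)
Lemma word_sum_bounded b n k :
  word_sum n k (fun w => (bounded b n w)%:R) = k`!%:R * path_weight b n k.
Proof.
elim: n k => [|n IH] k /=.
  by case: k => [|k]; rewrite /= ?mul1r // big_ord0 mulr0.
have -> : word_sum n.+1 k (fun w => (bounded b n.+1 w)%:R : rat) =
    word_sum n.+1 k (fun w =>
      (b n.+1 <= k)%N%:R * (bounded b n (filter (gtn n) w))%:R).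
  apply: eq_word_sum => w sw nw.
  rewrite -natrM mulnb /bounded.
  have -> : iota 1 n.+1 = iota 1 n ++ [:: n.+1].
    by rewrite -[n.+1]addn1 iotaD add1n addn1.
  rewrite all_cat /= andbT andbC.
  congr (_ && _)%:R.
    have /eqP-> : count (gtn n.+1) w == size w by rewrite -all_count.
    by rewrite sw.
  apply: eq_in_all => j; rewrite mem_iota => /andP[j0 jn].
  rewrite count_filter; congr (_ <= _)%N; apply: eq_count => x /=.
  by lia.
case: ifP => bk /=; last first.
  rewrite mulr0 -[RHS](word_sum0 _ n.+1 k).
  by apply: eq_word_sum => w _ _; rewrite mul0r.
under eq_word_sum do rewrite mul1r.
rewrite (word_sum_filter n k (fun w => (bounded b n w)%:R)) mulr_sumr.
apply: eq_bigr => i _; rewrite IH -mulr_natr.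
have ik : (i <= k)%N by rewrite -ltnS.
rewrite -(bin_fact ik) !natrM.
have := fact_gt0 (k - i); rewrite -(ltr_nat rat) => /lt0r_neq0 f0.
by field.
Qed.

Lemma triangle_sum (V : nmodType) k (P : pred nat) (F : nat -> nat -> V) :
  \sum_(i < k.+1) \sum_(c < i.+1 | P c) F c i =
  \sum_(c < k.+1 | P c) \sum_(d < (k - c).+1) F c (c + d)%N.
Proof.
under eq_bigr => i _ do
  rewrite (big_ord_widen_cond k.+1 P (F^~ i)) //.
rewrite (exchange_big_dep (fun c : 'I_k.+1 => P c)) /=; last by move=> i c _ /andP[].
apply: eq_bigr => c Pc.
under eq_bigl => i do rewrite Pc /= ltnS.
rewrite -(big_mkord (leq c) (F c)) -(big_mkord xpredT (fun d => F c (c + d)%N)).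
have ck : (c <= k.+1)%N by rewrite ltnW.
rewrite (big_cat_nat (n := c)) //= [X in X + _]big_nat_cond.
rewrite [X in X + _]big_pred0 ?add0r; last by move=> i; lia.
rewrite -{1}(add0n (c : nat)) big_addn subSn; last by rewrite -ltnS.
apply: congr_big_nat => // i _; [exact: leq_addl | by rewrite addnC].
Qed.

(* Conditioning on the first step instead of the last one. *)
Lemma path_weight_first b n k :
  path_weight b n.+1 k =
  \sum_(c < k.+1 | (b 1 <= c)%N)
     path_weight (fun j => b j.+1 - c)%N n (k - c) / c`!%:R.
Proof.
elim: n k => [|n IH] k.
  rewrite path_weightS big_ord_recl /= subn0 big1 ?addr0; last first.
    by move=> i _; rewrite mul0r.
  rewrite big_mkcond big_ord_recr /= subnn eqxx big1 ?add0r // => i _.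
  have -> : (k - i == 0)%N = false by have := ltn_ord i; lia.
  by rewrite mul0r if_same.
rewrite path_weightS; under eq_bigr => i _ do rewrite IH mulr_suml.
rewrite (triangle_sum k (leq (b 1%N)) (fun c i =>
  path_weight (fun j => b j.+1 - c)%N n (i - c) / c`!%:R / (k - i)`!%:R)).
case: ifP => bk.
  apply: eq_bigr => c _; rewrite path_weightS leq_sub2r // mulr_suml.
  by apply: eq_bigr => i _; rewrite addKn subnDA mulrAC.
rewrite big1 // => c _; rewrite path_weightS ifN ?mul0r //.
have := ltn_ord c; lia.
Qed.

(** Binomial theorem for [(x + 1) ^ k], divided by [k!]. *)
Lemma sum_exp_fact (x k : nat) :
  \sum_(c < k.+1) x%:R ^+ (k - c) * ((k - c)`!%:R^-1 * c`!%:R^-1) =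
  x.+1%:R ^+ k / k`!%:R :> rat.
Proof.
rewrite -natr1 exprDn mulr_suml; apply: eq_bigr => c _.
rewrite expr1n mulr1 -(mulr_natr (_ ^+ _)) -mulrA; congr (_ * _).
have ck : (c <= k)%N by rewrite -ltnS.
have f0 i : i`!%:R != 0 :> rat by rewrite pnatr_eq0 -lt0n fact_gt0.
rewrite -(bin_fact ck) !natrM; field.
by rewrite !f0 pnatr_eq0 -lt0n bin_gt0 ck.
Qed.

(* Ballot theorem: k! times this is the number of parking functions with k cars
   and k + D spots. *)
Lemma path_weight_ballot D k :
  path_weight (fun j => j - D)%N (k + D) k =
  D.+1%:R * (k + D).+1%:R ^ (k%:Z - 1) / k`!%:R.
Proof.
have [n kD] : exists n, (k + D)%N = n by exists (k + D)%N.
rewrite kD; elim: n k D kD => [|n IH] k D.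
  move=> kD; have [-> ->] : k = 0%N /\ D = 0%N by lia.
  by rewrite /= fact0 divr1 mul1r.
move=> kD; rewrite path_weight_first.
(* With [c] cars on the first spot, the rest is a ballot problem with parameter [D + c - 1]. The
   excluded case [D + c = 0] may be added, since the factor [D + c] kills it. *)
have -> : \sum_(c < k.+1 | (1 - D <= c)%N)
    path_weight (fun j => j.+1 - D - c)%N n (k - c) / c`!%:R =
   \sum_(c < k.+1) (D + c)%:R * (n.+1%:R ^+ (k - c) / n.+1%:R) / (k - c)`!%:R / c`!%:R.
  rewrite big_mkcond; apply: eq_bigr => c _; case: ifPn => Dc.
    have -> : path_weight (fun j => j.+1 - D - c)%N n (k - c) =
       path_weight (fun j => j - (D + c).-1)%N n (k - c).
      by apply: eq_path_weight => j _; lia.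
    have ck := ltn_ord c; rewrite IH; last by lia.
    rewrite prednK; last by lia.
    by rewrite expfzDr ?pnatr_eq0 // exprN1 -exprnP.
  have -> : (D + c = 0)%N by lia.
  by rewrite !mul0r.
have -> : \sum_(c < k.+1)
    (D + c)%:R * (n.+1%:R ^+ (k - c) / n.+1%:R) / (k - c)`!%:R / c`!%:R =
  n.+1%:R^-1 *
  (D%:R * (\sum_(c < k.+1) n.+1%:R ^+ (k - c) * ((k - c)`!%:R^-1 * c`!%:R^-1)) +
   \sum_(c < k.+1) c%:R * (n.+1%:R ^+ (k - c) * ((k - c)`!%:R^-1 * c`!%:R^-1))) :> rat.
  rewrite mulr_sumr -big_split mulr_sumr; apply: eq_bigr => c _ /=.
  by rewrite natrD; ring.
case: k kD => [|k] kD.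
  have -> : D = n.+1 by lia.
  rewrite !big_ord1 /= expr0 mul0r addr0 fact0 !invr1 !mulr1 sub0r exprN1.
  by rewrite mulVf ?mulfV ?pnatr_eq0.
rewrite sum_exp_fact [X in D%:R * _ + X]big_ord_recl mul0r add0r.
(* Since [c / c! = 1 / (c - 1)!], the second sum is again binomial, with exponent one less. *)
have -> : \sum_(i < k.+1) (bump 0 i)%:R * (n.+1%:R ^+ (k.+1 - bump 0 i) *
     ((k.+1 - bump 0 i)`!%:R^-1 * (bump 0 i)`!%:R^-1)) =
   \sum_(i < k.+1) n.+1%:R ^+ (k - i) * ((k - i)`!%:R^-1 * i`!%:R^-1) :> rat.
  apply: eq_bigr => i _; rewrite /bump leq0n add1n subSS factS natrM invfM.
  rewrite mulrCA; congr (_ * _); rewrite mulrCA mulVKf ?mulrA //.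
  by rewrite pnatr_eq0.
rewrite sum_exp_fact intS addrAC subrr add0r -exprnP exprS factS.
have -> : n.+1%:R = k.+1%:R + D%:R :> rat by rewrite -kD natrD.
have -> : n.+2%:R = k.+1%:R + D%:R + 1 :> rat by rewrite -kD -natrD natr1.
rewrite natrM -!natr1.
have f0 : k`!%:R != 0 :> rat by rewrite pnatr_eq0 -lt0n fact_gt0.
have k0 : 0 <= k%:R :> rat by [].
have D0 : 0 <= D%:R :> rat by [].
field.
clear kD IH; rewrite f0 /=; apply/andP; split; apply: lt0r_neq0; lra.
Qed.

End PathWeight.

(** * First passage decomposition *)

(* b allows the walk j - (c_1 + ... + c_j) one more level, K, than b' from time t
   on; x + K is the time of first passage to level K, reached with x cars. *)
Lemma path_weight_passage b b' K t :
    0 < K -> b' 0 = 0 ->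
    (forall j, j < t -> b j = b' j) ->
    (forall j, t <= j -> b j = j - K) ->
    (forall j, t <= j.+1 -> b' j = j.+1 - K) ->
  forall j C,
  path_weight b j C =
  (path_weight b' j C +
   \sum_(x < C.+1 | (t <= x + K <= j)%N)
     path_weight b' (x + K).-1%N x * path_weight id (j - (x + K)) (C - x))%R.
Proof.
move=> K0 b'0 blt bge b'ge; elim=> [|j IH] C.
  by rewrite big_pred0 ?addr0 // => x; lia.
have [jt|tj] := ltnP j.+1 t.
  rewrite big_pred0 ?addr0; last by move=> x; lia.
  by apply: eq_path_weight => i /andP[_ ij]; apply: blt; lia.
have b'S : b' j.+1 = j.+2 - K by apply: b'ge; lia.
have b'j : b' j = j.+1 - K by apply: b'ge.
rewrite path_weightS bge //; case: ifPn => jC; last first.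
  rewrite path_weightS b'S ifN; last by lia.
  rewrite add0r big1 // => x /andP[_ xj]; have xC := ltn_ord x.
  have -> : j.+1 - (x + K) = (j - (x + K)).+1 by lia.
  by rewrite path_weightS ifN ?mulr0 //; lia.
under eq_bigr => i _ do rewrite IH mulrDl mulr_suml.
rewrite big_split /=.
rewrite (triangle_sum C (fun x => t <= x + K <= j)%N (fun x i =>
  path_weight b' (x + K).-1%N x * path_weight id (j - (x + K)) (i - x)
   / (C - i)`!%:R)%R).
(* Passages up to time [j] come from the induction hypothesis; it remains to treat a passage exactly
   at time [j + 1]. *)
rewrite [X in (_ = _ + X)%R](bigID (fun x : 'I_C.+1 => x + K <= j)%N) /=.
rewrite [RHS]addrCA [RHS]addrC; congr (_ + _)%R; last first.
  apply: eq_big => [x|x /andP[_ xj]]; first by lia.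
  have xC := ltn_ord x.
  have -> : j.+1 - (x + K) = (j - (x + K)).+1 by lia.
  rewrite path_weightS ifT; last by lia.
  rewrite mulr_sumr; apply: eq_bigr => d _.
  by rewrite addKn (subnDA x C d) mulrA.
rewrite b'S; case: ifPn => jC'.
  rewrite [X in (_ + X)%R]big1 ?addr0 // => x xj; have xC := ltn_ord x.
  have -> : j.+1 - (x + K) = 0 by lia.
  rewrite /= (_ : C - x == 0 = false) ?mulr0 //; lia.
(* The walk is now exactly at level [K]. Under [b'] it was below [K] at time [j], so the last step
   carries no car, and this is the new passage term [x = C]. *)
have Cj : C + K = j.+1 by lia.
rewrite add0r [in RHS]big_mkcond !big_ord_recr /= !big1 ?add0r.
- rewrite Cj leqnn tj !subnn /= fact0 divr1 ifT ?mulr1 //; lia.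
- by move=> x _; have xC := ltn_ord x; rewrite ifN //; lia.
- move=> x _; have xC := ltn_ord x; rewrite path_weight_small ?mul0r //; lia.
Qed.

(* Letters of vs are 0-based, so count (gtn j) vs is the number of v_i <= j. *)
Definition lower_bound D (vs : seq nat) j := j - D - count (gtn j) vs.

(** The walk ends at level [D + size vs + 1], which the bounds of [vs] alone forbid, so only the
    passage terms survive. Passage with [x] cars happens at time [x + (D + size vs) + 1], which must
    be at least [a + 1], the spot of [a] counted from 1. *)
Lemma path_weight_rcons D vs a y : all (gtn a) vs -> a <= y + (D + size vs) ->
  path_weight (lower_bound D (rcons vs a)) (y + (D + size vs).+1) y =
  (\sum_(x < y.+1 | (a <= x + (D + size vs))%N)
    path_weight (lower_bound D vs) (x + (D + size vs)) x
    * path_weight id (y - x) (y - x))%R.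
Proof.
move=> vsa ay.
have cnt j : a <= j -> count (gtn j) vs = size vs.
  move=> aj; apply/eqP; rewrite -all_count; apply: sub_all vsa => x /=; lia.
rewrite (path_weight_passage (b' := lower_bound D vs) (K := (D + size vs).+1)
  (t := a.+1)) //.
- rewrite path_weight_small ?add0r //; last by rewrite /lower_bound cnt; lia.
  apply: eq_big => [x|x _]; first by have := ltn_ord x; lia.
  by rewrite !addnS /= subSS subnDr.
- by move=> j ja; rewrite /lower_bound -cats1 count_cat /=; lia.
- by move=> j ja; rewrite /lower_bound -cats1 count_cat /= cnt; lia.
- by move=> j ja; rewrite /lower_bound cnt; lia.
Qed.

(** The inequalities of $S_l(v)$ with [D] for $n-m$. Spots and indices are both counted from 0, so
    the two shifts cancel. *)
Definition admissible D (vs s : seq nat) : bool :=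
  all (fun i => nth 0 vs i <= sumn (take i.+1 s) + D + i) (iota 0 (size vs)).

(** Only the first block contains empty spots, [D] of them; every later block has as many spots as
    cars. *)
Definition block_weight D (s : seq nat) : rat :=
  (path_weight (subn^~ D) (head 0%N s + D) (head 0%N s)
   * \prod_(x <- behead s) path_weight id x x)%R.

Lemma admissible_rcons D vs a s z : size s = (size vs).+1 ->
  admissible D (rcons vs a) (rcons s z) =
  admissible D vs s && (a <= sumn s + (D + size vs)).
Proof.
move=> ss; rewrite /admissible size_rcons -[(size vs).+1]addn1 iotaD all_cat /=.
rewrite add0n andbT nth_rcons ltnn eqxx -(cats1 s z) take_size_cat // addnA.
congr (_ && _); apply: eq_in_all => i; rewrite mem_iota => /andP[_ ivs].
by rewrite nth_rcons ivs takel_cat //; lia.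
Qed.

(** Induction from the right end of [vs]: [path_weight_rcons] splits off the last block. [M] only
    bounds the block sizes; it stays fixed while the number [y] of cars varies. *)
Lemma path_weight_blocks D M vs y : pairwise ltn vs -> y <= M ->
    all (gtn (y + (D + size vs))) vs ->
  path_weight (lower_bound D vs) (y + (D + size vs)) y =
  word_sum M.+1 (size vs).+1 (fun s =>
    if admissible D vs s && (sumn s == y) then block_weight D s else 0%R).
Proof.
elim/last_ind: vs y => [|vs a IH] y.
  move=> _ yM _; have yM' : y < M.+1 by [].
  rewrite [RHS](bigD1 (Ordinal yM')) //= (addn0 y) eqxx [X in (_ + X)%R]big1 ?addr0.
    rewrite /block_weight /= big_nil mulr1 addn0.
    by apply: eq_path_weight => j _; rewrite /lower_bound subn0.
  by move=> x /negPf; rewrite -val_eqE /= addn0 => ->.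
rewrite pairwise_rcons all_rcons size_rcons => /andP[vsa pvs] yM /andP[ay _].
rewrite /= in ay.
rewrite addnS path_weight_rcons //; last by lia.
rewrite word_sum_rcons.
under eq_bigr => x ax.
  have xy := ltn_ord x.
  rewrite IH //; [|by lia|by apply: sub_all vsa => z /=; lia].
  rewrite -word_sum_mulr; over.
rewrite -exchange_word_sum; apply: eq_word_sum => s ss _.
under [RHS]eq_bigr => z _ do rewrite admissible_rcons // -cats1 sumn_cat /= addn0 cats1.
case: (admissible D vs s); last by rewrite !big1 // => x _; rewrite ?mul0r.
have [sy|ys] := leqP (sumn s) y; last first.
  rewrite !big1 // => x _; last by have xy := ltn_ord x; rewrite ifN ?mul0r //; lia.
  by rewrite ifN //; lia.
case: (leqP a (sumn s + (D + size vs))) => sa /=; last first.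
  rewrite !big1 // => x ax.
  by rewrite ifN ?mul0r //; lia.
have sy' : sumn s < y.+1 by [].
have zM : y - sumn s < M.+1 by lia.
(* Both sums reduce to one term: [sumn s] cars before the last passage, and a last block of size
   [y - sumn s]. *)
rewrite (bigD1 (Ordinal sy')) //= eqxx [X in (_ + X)%R]big1 ?addr0; last first.
  move=> x /andP[_]; rewrite -val_eqE /= => xs; rewrite ifN ?mul0r //; lia.
rewrite (bigD1 (Ordinal zM)) //= subnKC // eqxx [X in (_ = _ + X)%R]big1 ?addr0.
  case: s ss {sy sa sy' zM} => // u s _.
  by rewrite /block_weight /= -cats1 big_cat big_seq1 mulrA.
move=> z; rewrite -val_eqE /= => zs; rewrite ifN //; lia.
Qed.

(** * The counting formula *)

(** Complementary counting: at most [n - j] of the [m] cars prefer a spot from [j] on iff at least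
    [j - (n - m)] prefer an earlier one, and [vs] supplies a known part of these. *)
Lemma parks_cat (m n : nat) vs w : m <= n -> size (vs ++ w) = m ->
    all (gtn n) (vs ++ w) ->
  parks n (vs ++ w) = bounded (lower_bound (n - m) vs) n w.
Proof.
move=> mn sm vwn.
have cnt j : count (leq j) (vs ++ w) + (count (gtn j) vs + count (gtn j) w) = m.
  rewrite -sm -count_cat -(count_predC (leq j)); congr (_ + _).
  by apply: eq_count => x /=; lia.
rewrite /parks /bounded /lower_bound [iota 0 n.+1]/=.
rewrite [all _ (0 :: _)]/=.
(* The condition at 0 only says [m <= n]. *)
have -> /= : count (leq 0) (vs ++ w) <= n - 0 by have := cnt 0; lia.
apply: eq_in_all => j; rewrite mem_iota => jn; have := cnt j; lia.
Qed.

Lemma num_PF_path_weight (l m n : nat) (v : l.-tuple 'I_n) : l <= m -> m <= n ->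
  ((num_PF m v)%:R = (m - l)`!%:R
     * path_weight (lower_bound (n - m) (map val v)) n (m - l) :> rat)%R.
Proof.
move=> lm mn; set vs := map val v.
have svs : size vs = l by rewrite size_map size_tuple.
have vsn : all (gtn n) vs by apply/allP => _ /mapP[x _ ->]; apply: ltn_ord.
rewrite -word_sum_bounded.
transitivity (word_sum n m (fun w =>
   if take l w == vs then (parks n w)%:R else 0 : rat)%R).
  rewrite -sum_tuple_word /num_PF -sum1dep_card natr_sum big_mkcond /=.
  apply: eq_bigr => pi _; rewrite inE all_park0E -map_take.
  rewrite (inj_eq (inj_map val_inj)).
  by case: eqP => _; rewrite ?andbT ?andbF //; case: parks.
rewrite -[in word_sum n m _](subnKC lm) -svs word_sum_cat //.
apply: eq_word_sum => w sw wn.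
by rewrite (parks_cat (m := m)) ?size_cat ?all_cat ?vsn ?wn // sw svs subnKC.
Qed.

(** The ballot theorem for each block, with parameter 0 after the first. The factor [D + 1] does not
    depend on [s] and becomes the factor $n-m+1$ in front of the sum. *)
Lemma block_weightE D s : block_weight D s =
  (D.+1%:R * ((head 0%N s)%:R + D.+1%:R) ^ ((head 0%N s)%:Z - 1) / (head 0%N s)`!%:R
   * \prod_(x <- behead s) ((x%:R + 1) ^ (x%:Z - 1) / x`!%:R))%R.
Proof.
rewrite /block_weight path_weight_ballot -natrD addnS; congr (_ * _)%R.
apply: eq_bigr => x _; rewrite -{1}(addn0 x).
rewrite (_ : path_weight id _ _ = path_weight (subn^~ 0) (x + 0) x).
  by rewrite path_weight_ballot mul1r addn0 natr1.
by apply: eq_path_weight => j _; rewrite subn0.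
Qed.

Lemma values_mkseq l k (s : {ffun 'I_l.+1 -> 'I_k}) :
  [seq val (s i) | i <- enum 'I_l.+1] = mkseq (fun i => val (s (inord i))) l.+1.
Proof.
rewrite /mkseq -val_enum_ord -map_comp; apply: eq_map => i /=.
by rewrite inord_val.
Qed.

Lemma sum_take_values l k (s : {ffun 'I_l.+1 -> 'I_k}) i : i <= l ->
  sumn (take i.+1 [seq val (s j) | j <- enum 'I_l.+1]) =
  \sum_(j < l.+1 | j <= i) s j.
Proof.
move=> il; rewrite values_mkseq /mkseq -map_take take_iota sumnE big_map.
have -> : minn i.+1 l.+1 = i.+1 by lia.
rewrite -{1}(subn0 i.+1) -/(index_iota _ _).
rewrite big_mkord (big_ord_widen l.+1 (fun j => val (s (inord j)))) //.
by apply: eq_big => [j|j _] //; rewrite inord_val.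
Qed.

Lemma nth_spot l n (v : l.-tuple 'I_n) (i : 'I_l) :
  (nth 0 (map val v) i).+1 = spot v i.
Proof. by rewrite (nth_map (tnth v i)) ?size_tuple // -tnth_nth. Qed.

Lemma in_S_admissible l m n (v : l.-tuple 'I_n) k (s : {ffun 'I_l.+1 -> 'I_k}) :
  m <= n ->
  in_S m v (fun j => s j) =
  admissible (n - m) (map val v) [seq val (s j) | j <- enum 'I_l.+1]
  && (sumn [seq val (s j) | j <- enum 'I_l.+1] == m - l).
Proof.
move=> mn; rewrite /in_S; congr (_ && _); last first.
  by rewrite sumnE big_map big_enum.
rewrite /admissible size_map size_tuple.
have key (i : 'I_l) : (m%:Z - n%:Z + (spot v i)%:Z - (i.+1)%:Z
        <= (\sum_(j < l.+1 | (j <= i)%N) s j)%N%:Z)%R =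
  (nth 0 (map val v) i <=
     sumn (take i.+1 [seq val (s j) | j <- enum 'I_l.+1]) + (n - m) + i).
  rewrite sum_take_values; last by apply: ltnW.
  have -> : nth 0 (map val v) i = (spot v i).-1.
    by rewrite -nth_spot.
  move: (\sum_(j < _ | _) _) => S; have : 0 < spot v i by [].
  by lia.
apply/forallP/allP => H i.
  rewrite mem_iota => /andP[_ il]; have := H (Ordinal il); by rewrite key.
by rewrite key; apply: H; rewrite mem_iota ltn_ord.
Qed.

Lemma block_weight_summand l m n k (s : {ffun 'I_l.+1 -> 'I_k}) : m <= n ->
  ((m - l)`!%:R * block_weight (n - m) [seq val (s j) | j <- enum 'I_l.+1] =
   (n%:R - m%:R + 1) * PF_summand m n (fun j => s j))%R.
Proof.
move=> mn; rewrite block_weightE /PF_summand /multinomial enum_ordSl /=.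
rewrite -map_comp big_map big_enum /= big_split /= prodfV.
have tail (F : 'I_l.+1 -> rat) :
    (\prod_(j < l.+1 | j != ord0) F j = \prod_(i in 'I_l) F (lift ord0 i))%R.
  by rewrite big_mkcond big_ord_recl /= mul1r.
have full (F : 'I_l.+1 -> rat) :
    (\prod_(j < l.+1) F j = F ord0 * \prod_(i in 'I_l) F (lift ord0 i))%R.
  by rewrite big_ord_recl.
rewrite tail full invfM -natr1 natrB //.
have -> : ((s ord0)%:R + (n%:R - m%:R + 1) = (s ord0)%:R + 1 + n%:R - m%:R :> rat)%R.
  by ring.
by ring.
Qed.

Lemma num_PF_formula l m n (v : l.-tuple 'I_n) : l <= m -> m <= n ->
  strictly_increasing v -> ((num_PF m v)%:R = PF_formula m v :> rat)%R.
Proof.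
move=> lm mn incv; rewrite num_PF_path_weight //.
have e : n = m - l + (n - m + size (map val v)).
  by rewrite size_map size_tuple; lia.
have vn : all (gtn n) (map val v).
  by apply/allP => _ /mapP[x _ ->]; apply: ltn_ord.
have vlt : pairwise ltn (map val v).
  apply/(pairwiseP 0) => i j; rewrite !inE size_map size_tuple => il jl ij.
  suff : (nth 0 (map val v) i).+1 < (nth 0 (map val v) j).+1 by [].
  rewrite (nth_spot v (Ordinal il)) (nth_spot v (Ordinal jl)).
  exact: incv.
have := @path_weight_blocks (n - m) (m - l) (map val v) (m - l).
rewrite -e => -> //.
rewrite size_map size_tuple -sum_ffun_word /PF_formula !mulr_sumr [RHS]big_mkcond.
apply: eq_bigr => s _; rewrite in_S_admissible //.
by case: ifP => _; rewrite ?mulr0 // block_weight_summand.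
Qed.

(** * Comparison of the index sets *)

Lemma PF_summand_gt0 l m n (s : 'I_l.+1 -> nat) : m <= n ->
  (0 < PF_summand m n s)%R.
Proof.
move=> mn; rewrite /PF_summand /multinomial.
have fact0 k : (0 < k`!%:R :> rat)%R by rewrite ltr0n fact_gt0.
apply: mulr_gt0; first apply: mulr_gt0.
- by rewrite divr_gt0 // prodr_gt0.
- by rewrite exprz_gt0 // -addrA -addrA -natrB // nat1r -natrD addnS.
- by apply: prodr_gt0 => j _; rewrite exprz_gt0 // natr1 ltr0n.
Qed.

Lemma spot_gap l n (v : l.-tuple 'I_n) (i j : 'I_l) : strictly_increasing v ->
  i <= j -> spot v i + (j - i) <= spot v j.
Proof.
move=> incv /subnKC; move: (j - i) => d; elim: d j => [|d IH] j ijd.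
  by have -> : i = j by [apply: ord_inj; lia]; rewrite addn0.
have kl : i + d < l by have := ltn_ord j; lia.
have := IH (Ordinal kl) erefl; have := incv (Ordinal kl) j; rewrite /= -ijd; lia.
Qed.

Lemma spot_le l n (v : l.-tuple 'I_n) (i : 'I_l) : strictly_increasing v ->
  spot v i + (l - i.+1) <= n.
Proof.
move=> incv; have il := ltn_ord i; have ll : l.-1 < l by lia.
have iL : i <= Ordinal ll by rewrite /=; lia.
have := spot_gap incv iL; rewrite {2}/spot /=.
have := ltn_ord (tnth v (Ordinal ll)); lia.
Qed.

(* The extreme element of S_l(v), all of whose lower bounds (truncated at 0)
   are attained. *)
Lemma in_S_tight l m n (v : l.-tuple 'I_n) : l <= m -> m <= n ->
    strictly_increasing v ->
  exists2 s : {ffun 'I_l.+1 -> 'I_(m - l).+1}, in_S m v (fun j => s j) &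
    forall i : 'I_l,
      \sum_(j < l.+1 | j <= i) s j = spot v i - (n - m + i.+1).
Proof.
move=> lm mn incv.
(* [B k] is the prescribed sum of the first [k + 1] entries: the truncated lower bound for [k < l],
   and the total [m - l] at [k = l]. *)
pose B k := if insub k is Some i then spot v i - (n - m + k.+1) else m - l.
have BE (i : 'I_l) : B i = spot v i - (n - m + i.+1) by rewrite /B valK.
have Bl : B l = m - l by rewrite /B insubF // ltnn.
(* Monotone because [v] increases strictly, and at the end because the last spot is at most [n];
   hence the increments of [B] are the entries of a valid [s]. *)
have Bmono k : k < l -> B k <= B k.+1.
  move=> kl; have [kl'|lk] := ltnP k.+1 l.
    have := @spot_gap _ _ v (Ordinal kl) (Ordinal kl') incv.
    by rewrite -[k]/(val (Ordinal kl)) -[_.+1]/(val (Ordinal kl')) !BE /=; lia.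
  have -> : k.+1 = l by lia.
  rewrite Bl -[k]/(val (Ordinal kl)) BE /=.
  by have := spot_le (Ordinal kl) incv => /=; lia.
pose f k := if k is k'.+1 then B k - B k' else B 0.
have sumf k : k <= l -> \sum_(j < k.+1) f j = B k.
  elim: k => [|k IH] kl; first by rewrite big_ord1.
  by rewrite big_ord_recr /= IH ?subnKC ?Bmono //; lia.
have sumf' (i : 'I_l) : \sum_(j < l.+1 | j <= i) f j = spot v i - (n - m + i.+1).
  rewrite -BE -sumf; last exact: ltnW.
  by rewrite (big_ord_widen l.+1) // ltnS ltnW.
have Sf : in_S m v (fun j => f j).
  apply/andP; split; last by rewrite sumf // Bl.
  by apply/forallP => i; rewrite sumf'; lia.
exists [ffun j => Ordinal (in_S_bound Sf j)].
  case/andP: (Sf) => /forallP H1 H2.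
  apply/andP; split; last by under eq_bigr do rewrite ffunE.
  by apply/forallP => i; under eq_bigr do rewrite ffunE; apply: H1.
by move=> i; rewrite -sumf'; apply: eq_bigr => j _; rewrite ffunE.
Qed.

Theorem theorem2p5 (l m n : nat) (l_ge1 : 1 <= l) (le_lm : l <= m)
    (le_mn : m <= n) :
  (forall v : l.-tuple 'I_n, strictly_increasing v ->
     ((num_PF m v)%:R = PF_formula m v :> rat)%R)
  /\ (forall v v' : l.-tuple 'I_n,
        strictly_increasing v -> strictly_increasing v' ->
        (forall i : 'I_l, spot v i <= n - m + i.+1) ->
        (forall i : 'I_l, spot v' i <= n - m + i.+1) ->
        num_PF m v = num_PF m v')
  /\ (forall (v v' : l.-tuple 'I_n) (i : 'I_l),
        strictly_increasing v -> strictly_increasing v' ->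
        (forall j : 'I_l, j != i -> spot v' j = spot v j) ->
        n - m + i.+1 <= spot v i -> spot v i < spot v' i ->
        num_PF m v' < num_PF m v).
Proof.
have formula (v : l.-tuple 'I_n) : strictly_increasing v ->
    ((num_PF m v)%:R = PF_formula m v :> rat)%R.
  exact: num_PF_formula.
have D0 : (0 < n%:R - m%:R + 1 :> rat)%R by rewrite -natrB // natr1 ltr0n.
split=> //; split=> [v v' incv incv' lev lev'|v v' i incv incv' eqv lev ltv].
  apply/eqP; rewrite -(eqr_nat rat) !formula //; apply/eqP.
  congr (_ * _)%R; apply: eq_bigl => s; congr (_ && _).
  (* All lower bounds are at most 0, so they hold trivially for both tuples. *)
  by apply: eq_forallb => i; have := lev i; have := lev' i; lia.
rewrite -(ltr_nat rat) !formula // ltr_pM2l //.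
(* All summands are positive, so it suffices that $S_l(v')$ is a proper subset of $S_l(v)$. The
   tight [s] is missing from it: as $v_i\ge n-m+i$, its [i]th bound is attained without truncation,
   and the bound for [v'] is larger. *)
have [s Ss tight] := in_S_tight le_lm le_mn incv.
have S's : ~~ in_S m v' (fun j => s j).
  by apply/nandP; left; apply/forallPn; exists i; rewrite tight; lia.
rewrite [ltRHS](bigID (fun s : {ffun 'I_l.+1 -> 'I_(m - l).+1} =>
  in_S m v' (fun j => s j))) /=.
rewrite [ltLHS](eq_bigl (fun s : {ffun 'I_l.+1 -> 'I_(m - l).+1} =>
  in_S m v (fun j => s j) && in_S m v' (fun j => s j))); last first.
  move=> t /=; apply/idP/andP => [S't|[] //]; split=> //.
  move: S't => /andP[/forallP H tot]; apply/andP; split=> //.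
  apply/forallP => j; have := H j.
  by have [->|/eqv ->] := eqVneq j i; last exact; lia.
rewrite ltrDl (bigD1 s) ?Ss //=; apply: ltr_wpDr; last exact: PF_summand_gt0.
by apply: sumr_ge0 => t _; apply/ltW/PF_summand_gt0.
Qed.
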